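(* Let $n\ge 1$ be an integer and let $\Gamma=TRC_4C_8(R)[n,n]$. Let $g_1,g_2,g_3,g_4:V(\Gamma)\to V(\Gamma)$ be the maps given, for all $i,j\in\{1,\dots,n\}$ (indices modulo $n$), by \begin{align*} g_1&:\ v_{j,i}^t\mapsto v_{j,i-1}^t,\quad t=0,1,2,3,\\ g_2&:\ v_{j,i}^t\mapsto v_{j+1,i}^t,\quad t=0,1,2,3,\\ g_3&:\ v_{j,i}^3\mapsto v_{i,j}^2,\ v_{j,i}^2\mapsto v_{i,j}^3,\ v_{j,i}^1\mapsto v_{i,j}^0,\ v_{j,i}^0\mapsto v_{i,j}^1,\\ g_4&:\ v_{j,i}^3\mapsto v_{n-j+1,n-i+1}^0,\ v_{j,i}^2\mapsto v_{n-j+1,n-i+1}^1,\ v_{j,i}^1\mapsto v_{n-j+1,n-i+1}^2,\ v_{j,i}^0\mapsto v_{n-j+1,n-i+1}^3, \end{align*} and let $G=\langle g_1,g_2,g_3,g_4\rangle$ be the group (under composition) generated by these maps. Then $\Gamma$ is a Cayley graph on $G$, and $G\cong (C_n\times C_n)\rtimes(C_2\times C_2)$ (a semidirect product with normal factor $C_n\times C_n$).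
   Context: The graph $TRC_4C_8(R)[n,n]$ (rhomboidal $C_4C_8$ nanotorus) is the simple undirected graph with vertex set $\{v_{j,i}^t : 1\le i\le n,\ 1\le j\le n,\ t\in\{0,1,2,3\}\}$ ($4n^2$ distinct vertices) and edges, for all $i,j$, $$v_{j,i}^0v_{j,i}^1,\quad v_{j,i}^0v_{j,i}^2,\quad v_{j,i}^1v_{j,i}^3,\quad v_{j,i}^2v_{j,i}^3,\quad v_{j,i}^0v_{j+1,i}^3,\quad v_{j,i}^1v_{j,i+1}^2,$$ where subscripts are read modulo $n$ (with representatives $1,\dots,n$). For a finite group $G$ and a subset $S\subseteq G$ with $1\notin S$ and $s^{-1}\in S$ for every $s\in S$, the Cayley graph $Cay(G,S)$ has vertex set $G$ and an edge joining $g$ to $sg$ for all $g\in G$, $s\in S$. A graph is a Cayley graph on $G$ if it is isomorphic to $Cay(G,S)$ for some such $S$. $C_k$, when referring to a group, denotes the cyclic group of order $k$. A group $G$ is a semidirect product $H\rtimes K$ of subgroups $H,K$ if $G=HK$, $H$ is normal in $G$ and $H\cap K=\{1\}$. *)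

(* Defs.v *)
From mathcomp Require Import all_boot all_fingroup zmodp.

Set Implicit Arguments.
Unset Strict Implicit.
Unset Printing Implicit Defensive.

Import GroupScope.

Definition graph_iso (T1 T2 : finType) (e1 : rel T1) (e2 : rel T2) : Prop :=
  exists2 f : T1 -> T2, bijective f & forall x y, e2 (f x) (f y) = e1 x y.

Definition cayley_adj (gT : finGroupType) (S : {set gT}) : rel gT :=
  fun g h => [exists s in S, h == s * g].

Definition is_cayley_graph_on (gT : finGroupType) (T : finType) (e : rel T) :
    Prop :=
  exists S : {set gT},
    [/\ 1 \notin S, {in S, forall s, s^-1 \in S} & graph_iso e (cayley_adj S)].

(* The vertex v_{j,i}^t is the triple (j, i, t). The ordinal k : 'I_n stands
   for the subscript k + 1 of {1, ..., n}; since 1 <= n, the maps j |-> j + 1,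
   j |-> j - 1 (mod n) and j |-> n - j + 1 on subscripts are then ordS,
   ord_pred and rev_ord. *)
Notation vertex n := ('I_n * 'I_n * 'I_4)%type.

Definition TRC_arc (n : nat) : rel (vertex n) := fun x y =>
  let: (j, i, s) := x in
  let: (j', i', t) := y in
  [|| [&& j' == j, i' == i &
          (s : nat, t : nat) \in [:: (0, 1); (0, 2); (1, 3); (2, 3)]%N],
      [&& j' == ordS j, i' == i, s == 0%N :> nat & t == 3%N :> nat]
    | [&& j' == j, i' == ordS i, s == 1%N :> nat & t == 2%N :> nat]].

Definition TRC_adj (n : nat) : rel (vertex n) := fun x y =>
  TRC_arc x y || TRC_arc y x.

Lemma TRC_adj_sym n : symmetric (@TRC_adj n).
Proof. by move=> x y; rewrite /TRC_adj orbC. Qed.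

Lemma TRC_adj_irr n : irreflexive (@TRC_adj n).
Proof.
move=> [[j i] [[|[|[|[|t]]]] lt4]] //=; by rewrite /TRC_adj /= !eqxx !andbF.
Qed.

Definition g1_fun (n : nat) (x : vertex n) : vertex n :=
  let: (j, i, t) := x in (j, ord_pred i, t).

Definition g2_fun (n : nat) (x : vertex n) : vertex n :=
  let: (j, i, t) := x in (ordS j, i, t).

Definition g3_fun (n : nat) (x : vertex n) : vertex n :=
  let: (j, i, t) := x in (i, j, inord (nth 0 [:: 1; 0; 3; 2] t)%N).

Definition g4_fun (n : nat) (x : vertex n) : vertex n :=
  let: (j, i, t) := x in
  (rev_ord j, rev_ord i, inord (nth 0 [:: 3; 2; 1; 0] t)%N).

Lemma g1_inj n : injective (@g1_fun n).
Proof.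
apply: (@can_inj _ _ _ (fun x => (x.1.1, ordS x.1.2, x.2))) => -[[j i] t] /=.
by rewrite ord_predK.
Qed.

Lemma g2_inj n : injective (@g2_fun n).
Proof.
apply: (@can_inj _ _ _ (fun x => (ord_pred x.1.1, x.1.2, x.2))) => -[[j i] t] /=.
by rewrite ordSK.
Qed.

Lemma g3_inj n : injective (@g3_fun n).
Proof.
apply: inv_inj => -[[j i] t]; rewrite /g3_fun; congr (_, _, _).
by apply: val_inj; case: t => [[|[|[|[|t]]]] lt4] //=; do 2!rewrite inordK /=.
Qed.

Lemma g4_inj n : injective (@g4_fun n).
Proof.
apply: inv_inj => -[[j i] t]; rewrite /g4_fun !rev_ordK; congr (_, _, _).
by apply: val_inj; case: t => [[|[|[|[|t]]]] lt4] //=; do 2!rewrite inordK /=.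
Qed.

Definition g1 (n : nat) : {perm vertex n} := perm (@g1_inj n).
Definition g2 (n : nat) : {perm vertex n} := perm (@g2_inj n).
Definition g3 (n : nat) : {perm vertex n} := perm (@g3_inj n).
Definition g4 (n : nat) : {perm vertex n} := perm (@g4_inj n).

(* The product s * t of {perm _} applies s first, so this is the opposite of
   the group under composition; g |-> g^-1 identifies the two. *)
Definition TRC_group (n : nat) : {group {perm vertex n}} :=
  <<[set g1 n; g2 n; g3 n; g4 n]>>%G.

(* C_k x C_k; Zp 1 is the trivial group, although the type 'Z_1 has two
   elements. *)
Definition cyclic_square (k : nat) : {group 'Z_k * 'Z_k} :=
  setX_group (Zp_group k) (Zp_group k).

(* Main.v *)
(* Every vertex is determined by its cell (j, i) and its type t.  The
   translations g1 and g2 move cells regularly and fix types, while g3 and g4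
   move types regularly, so the group generated by the four maps is a semidirect
   product of <g1, g2> by <g3, g4> which acts regularly on the vertices; as it
   acts by graph automorphisms, Sabidussi's criterion applies. *)
Require Import Defs.
From mathcomp Require Import all_boot all_fingroup all_solvable zmodp.

Import GroupScope.

(** * Cyclic shifts and reversal of subscripts *)

Lemma iter_ordS n k (i : 'I_n) : iter k (@ordS n) i = (i + k) %% n :> nat.
Proof.
elim: k => [|k IHk]; first by rewrite addn0 modn_small.
by rewrite iterS /= IHk -addn1 modnDml addn1 addnS.
Qed.

Lemma iter_ordS_fix n k (i : 'I_n) : (iter k (@ordS n) i == i) = (n %| k).
Proof.
rewrite -val_eqE /= iter_ordS -[X in _ == X](modn_small (ltn_ord i)).
by rewrite -[in X in _ == X](addn0 i) eqn_modDl mod0n.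
Qed.

Lemma iter_ord_pred_fix n k (i : 'I_n) :
  (iter k (@ord_pred n) i == i) = (n %| k).
Proof.
have iterK : cancel (iter k (@ord_pred n)) (iter k (@ordS n)).
  by elim: k => // k IHk x; rewrite iterSr iterS ord_predK IHk.
by rewrite (canF_eq iterK) eq_sym iter_ordS_fix.
Qed.

Lemma rev_ord_pred n (i : 'I_n) : rev_ord (ord_pred i) = ordS (rev_ord i).
Proof.
(* At 0 the predecessor wraps around to n - 1, so this subscript is treated apart. *)
apply: val_inj => /=; case: i => [[|i] lt_in] /=.
  rewrite add0n modn_small ?prednK ?ltn_predL //.
  by rewrite subnn subn1 prednK // modnn.
rewrite modnDr modn_small ?(ltnW lt_in) // subnSK // modn_small //.
by rewrite ltn_subrL (leq_ltn_trans _ lt_in).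
Qed.

(** * General facts on products of cyclic groups and on regular actions *)

Lemma isog_cyclic_square (gT : finGroupType) (x y : gT) k :
    0 < k -> commute x y -> <[x]> :&: <[y]> = 1 -> #[x] = k -> #[y] = k ->
  <[x]> <*> <[y]> \isog cyclic_square k.
Proof.
move=> k_gt0 cxy tixy ox oy.
have cyc_isog (z : gT) : #[z] = k -> <[z]> \isog Zp k.
  move=> oz; rewrite (isog_cyclic_card (Zp_group k)) ?cycle_cyclic //.
  rewrite card_Zp // -orderE oz eqxx andbT /= /Zp.
  (* [Zp k] is all of ['Z_k] for k > 1 and trivial for k = 1; it is cyclic either way. *)
  by case: ifP => _; rewrite ?cyclic1 // Zp_cycle cycle_cyclic.
apply: isog_dprod (setX_dprod (Zp_group k) (Zp_group k)) _ _.
- by apply: dprodEY => //; rewrite cycle_subG /= cent_cycle; apply/cent1P.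
- rewrite -morphim_pairg1; apply: isog_trans (cyc_isog _ ox) _.
  exact: sub_isog (subsetT _) (injm_pairg1 _ _).
- rewrite -morphim_pair1g; apply: isog_trans (cyc_isog _ oy) _.
  exact: sub_isog (subsetT _) (injm_pair1g _ _).
Qed.

(** Freeness and the cardinality make g |-> g x0 a bijection, and S consists of the g that send x0
    to a neighbour. As [s * g] applies s first, the pair of g x0 and (s * g) x0 is the image under g
    of the pair of x0 and s x0. *)
Lemma regular_cayley (T : finType) (e : rel T) (G : {group {perm T}}) (x0 : T) :
    symmetric e -> irreflexive e ->
    {in G, forall (g : {perm T}) x y, e x y -> e (g x) (g y)} ->
    #|G| = #|T| -> {in G, forall g : {perm T}, g x0 = x0 -> g = 1} ->
  is_cayley_graph_on [subg G]%type e.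
Proof.
move=> e_sym e_irr e_aut cardG freeG.
pose phi (g : [subg G]%type) := sgval g x0.
have phi_inj : injective phi.
  move=> g h eq_gh; apply/val_inj/eqP; rewrite eq_mulgV1; apply/eqP.
  apply: freeG; first by rewrite groupM ?groupV ?subgP.
  by rewrite permM [sgval g x0]eq_gh permK.
have [f phiK fK] : bijective phi.
  by apply: inj_card_bij => //; rewrite -cardG card_sub.
exists [set s | e x0 (phi s)]; split.
- by rewrite inE /phi perm1 e_irr.
- move=> s; rewrite !inE e_sym => /(e_aut _ (groupVr (subgP s))).
  by rewrite /phi permK.
exists f => [|x y]; first by exists phi.
have phiM s g : phi (s * g) = sgval g (phi s) by rewrite /phi permM.
apply/exists_inP/idP => [[s] | exy].
  rewrite inE => e_s /eqP def_y.
  by rewrite -(fK x) -(fK y) def_y phiM e_aut ?subgP.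
(* The inverse of [f x] carries the edge from x to y to an edge that starts at x0. *)
exists (f y * (f x)^-1); last by rewrite mulgKV.
rewrite inE phiM fK -[x0](permK (sgval (f x))) -/(phi _) fK.
by rewrite e_aut ?groupV ?subgP.
Qed.

(** * Powers, orders and relations of the generators *)

Section Torus.

Variable n : nat.
Implicit Types (x y : vertex n) (g h : {perm vertex n}).

Lemma g1X k x : (g1 n ^+ k) x = (x.1.1, iter k (@ord_pred n) x.1.2, x.2).
Proof.
rewrite permX; elim: k => [|k IHk]; first by case: x => -[].
by rewrite iterS IHk permE.
Qed.

Lemma g2X k x : (g2 n ^+ k) x = (iter k (@ordS n) x.1.1, x.1.2, x.2).
Proof.
rewrite permX; elim: k => [|k IHk]; first by case: x => -[].
by rewrite iterS IHk permE.
Qed.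

(** All second subscripts shift by the same amount, so a single fixed vertex already forces n to
    divide k. *)
Lemma g1X_eq1 k x : (g1 n ^+ k) x = x -> g1 n ^+ k = 1.
Proof.
rewrite g1X => /(congr1 (fun y => y.1.2)) /= /eqP; rewrite iter_ord_pred_fix => k_n.
apply/permP => -[[j i] t]; rewrite g1X perm1 /=; congr (_, _, _).
by apply/eqP; rewrite iter_ord_pred_fix.
Qed.

Lemma g2X_eq1 k x : (g2 n ^+ k) x = x -> g2 n ^+ k = 1.
Proof.
rewrite g2X => /(congr1 (fun y => y.1.1)) /= /eqP; rewrite iter_ordS_fix => k_n.
apply/permP => -[[j i] t]; rewrite g2X perm1 /=; congr (_, _, _).
by apply/eqP; rewrite iter_ordS_fix.
Qed.

Lemma order_g1 : 0 < n -> #[g1 n] = n.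
Proof.
move=> n_gt0; pose x : vertex n := (Ordinal n_gt0, Ordinal n_gt0, ord0).
apply/eqP; rewrite eqn_dvd order_dvdn; apply/andP; split.
  by apply/eqP/(@g1X_eq1 _ x); rewrite g1X; congr (_, _, _); apply/eqP;
     rewrite iter_ord_pred_fix.
rewrite -(@iter_ord_pred_fix n _ (Ordinal n_gt0)).
by have := g1X #[g1 n] x; rewrite expg_order perm1 => -[{2}->].
Qed.

Lemma order_g2 : 0 < n -> #[g2 n] = n.
Proof.
move=> n_gt0; pose x : vertex n := (Ordinal n_gt0, Ordinal n_gt0, ord0).
apply/eqP; rewrite eqn_dvd order_dvdn; apply/andP; split.
  by apply/eqP/(@g2X_eq1 _ x); rewrite g2X; congr (_, _, _); apply/eqP;
     rewrite iter_ordS_fix.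
rewrite -(@iter_ordS_fix n _ (Ordinal n_gt0)).
by have := g2X #[g2 n] x; rewrite expg_order perm1 => -[{2}->].
Qed.

Lemma expg_g3_2 : g3 n ^+ 2 = 1.
Proof.
apply/permP => -[[j i] [[|[|[|[|t]]]] lt4]] //; rewrite expgS expg1 permM perm1 !permE /=;
  by congr (_, _, _); apply: val_inj; rewrite /= !inordK.
Qed.

Lemma expg_g4_2 : g4 n ^+ 2 = 1.
Proof.
apply/permP => -[[j i] [[|[|[|[|t]]]] lt4]] //; rewrite expgS expg1 permM perm1 !permE /=;
  rewrite !rev_ordK; by congr (_, _, _); apply: val_inj; rewrite /= !inordK.
Qed.

Lemma commute_g1_g2 : commute (g1 n) (g2 n).
Proof. by apply/permP => -[[j i] t]; rewrite !permM !permE. Qed.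

Lemma commute_g3_g4 : commute (g3 n) (g4 n).
Proof.
apply/permP => -[[j i] [[|[|[|[|t]]]] lt4]] //; rewrite !permM !permE /=;
  by congr (_, _, _); apply: val_inj; rewrite /= !inordK.
Qed.

(** [g3] exchanges the two subscripts; the inverse appears because [g1] lowers i whereas [g2] raises
    j. *)
Lemma g1J3 : g1 n ^ g3 n = (g2 n)^-1.
Proof.
(* Clearing inverses leaves [g1 n * g3 n * g2 n = g3 n], which is checked vertex by vertex. *)
apply: (mulIg (g2 n)); apply: (mulgI (g3 n)); rewrite mulVg mulg1.
rewrite mulgA -conjgC; apply/permP => -[[j i] t].
by rewrite !permM !permE /= ord_predK.
Qed.

Lemma g2J3 : g2 n ^ g3 n = (g1 n)^-1.
Proof.
apply: (mulIg (g1 n)); apply: (mulgI (g3 n)); rewrite mulVg mulg1.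
rewrite mulgA -conjgC; apply/permP => -[[j i] t].
by rewrite !permM !permE /= ordSK.
Qed.

(** Reversing a subscript turns a shift into the opposite shift. *)
Lemma g1J4 : g1 n ^ g4 n = (g1 n)^-1.
Proof.
apply: (mulIg (g1 n)); apply: (mulgI (g4 n)); rewrite mulVg mulg1.
rewrite mulgA -conjgC; apply/permP => -[[j i] t].
by rewrite !permM !permE /= rev_ord_pred ordSK.
Qed.

Lemma g2J4 : g2 n ^ g4 n = (g2 n)^-1.
Proof.
apply: (mulIg (g2 n)); apply: (mulgI (g4 n)); rewrite mulVg mulg1.
rewrite mulgA -conjgC; apply/permP => -[[j i] t].
by rewrite !permM !permE /= -rev_ord_pred ordSK.
Qed.

(** * The subgroups of translations and of type changes *)

Definition translations : {group {perm vertex n}} := <[g1 n]> <*> <[g2 n]>.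

Definition type_changes : {group {perm vertex n}} := <[g3 n]> <*> <[g4 n]>.

Lemma TRC_groupE : translations <*> type_changes = TRC_group n.
Proof.
have joing_cycles g h : <[g]> <*> <[h]> = <<[set g; h]>>.
  by rewrite joing_idl joing_idr.
by rewrite /= !joing_cycles joing_idl joing_idr joingE !setUA.
Qed.

(** Up to inverses, conjugation by [g3] swaps the generators [g1] and [g2], and conjugation by [g4]
    fixes each. *)
Lemma type_changes_norm : type_changes \subset 'N(translations).
Proof.
rewrite join_subG !cycle_subG !inE /= !conjYg -!cycleJ.
by rewrite g1J3 g2J3 g1J4 g2J4 !cycleV subxx andbT joingC.
Qed.

Lemma translationsP h :
  reflect (exists a b, h = g1 n ^+ a * g2 n ^+ b) (h \in translations).
Proof.
rewrite /= cent_joinEl; last first.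
  by rewrite cycle_subG /= cent_cycle; apply/cent1P/commute_g1_g2.
apply: (iffP mulsgP) => [[_ _ /cycleP[a ->] /cycleP[b ->]]|[a [b ->]]].
  by exists a, b.
by exists (g1 n ^+ a) (g2 n ^+ b); rewrite ?mem_cycle.
Qed.

Lemma translation_type h x : h \in translations -> (h x).2 = x.2.
Proof. by case/translationsP=> a [b ->]; rewrite permM g2X g1X. Qed.

Lemma translation_free h x : h \in translations -> h x = x -> h = 1.
Proof.
case/translationsP=> a [b ->] fix_x.
(* Only the power of [g1] acts on i, so the i-coordinate of [fix_x] isolates it. *)
have fix1 : (g1 n ^+ a) x = x.
  by case: x fix_x => -[j i] t; rewrite permM g2X !g1X /= => -[_ ->].
by move: fix_x; rewrite permM fix1 (g1X_eq1 _ _ fix1) mul1g => /g2X_eq1.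
Qed.

Lemma type_changesP k :
  k \in type_changes -> exists a b : bool, k = g3 n ^+ a * g4 n ^+ b.
Proof.
rewrite /= cent_joinEl; last first.
  by rewrite cycle_subG /= cent_cycle; apply/cent1P/commute_g3_g4.
case/mulsgP=> _ _ /cycleP[a ->] /cycleP[b ->] ->; exists (odd a), (odd b).
by rewrite -!modn2 (expg_mod _ expg_g3_2) (expg_mod _ expg_g4_2).
Qed.

(** On types, [g3], [g4] and their product act as (0 1)(2 3), (0 3)(1 2) and (0 2)(1 3), none of
    which has a fixed point. *)
Lemma type_change_free k x : k \in type_changes -> (k x).2 = x.2 -> k = 1.
Proof.
case/type_changesP=> -[] [[] ->]; rewrite ?mulg1 ?mul1g //;
  move=> /(congr1 val); case: x => -[j i] [[|[|[|[|t]]]] lt4] //;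
  by rewrite ?permM !permE /= ?inordK // inordK.
Qed.

(** * Action by graph automorphisms *)

Lemma TRC_group_aut g : g \in TRC_group n ->
  forall x y, TRC_adj x y -> TRC_adj (g x) (g y).
Proof.
pose A := [set h : {perm vertex n} |
  [forall x, forall y, TRC_adj x y ==> TRC_adj (h x) (h y)]].
have AP h : reflect (forall x y, TRC_adj x y -> TRC_adj (h x) (h y)) (h \in A).
  rewrite inE; apply: (iffP forallP) => [Ah x y | Ah x].
    by move: (Ah x) => /forallP/(_ y)/implyP.
  by apply/forallP=> y; apply/implyP/Ah.
(* In a finite group, closure under products suffices for a subgroup, so only the generators remain
   to be tested. *)
have group_A : group_set A.
  apply/group_setP; split; first by apply/AP=> x y; rewrite !perm1.
  by move=> h k /AP Ah /AP Ak; apply/AP=> x y exy; rewrite !permM; apply/Ak/Ah.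
have arcP h : (forall x y, TRC_arc x y -> TRC_adj (h x) (h y)) -> h \in A.
  by move=> Ah; apply/AP=> x y /orP[]/Ah; rewrite // TRC_adj_sym.
suffices /subsetP sGA : TRC_group n \subset Group group_A by move/sGA/AP.
rewrite gen_subG; apply/subsetP=> h gen_h; rewrite -[_ \in _]/(h \in A).
apply: arcP; move: gen_h; rewrite !inE -!orbA.
case/or4P=> /eqP-> [[j i] s] [[j' i'] t]; rewrite !permE /TRC_adj /=.
(* The three kinds of arc are those inside a cell, those raising j and those raising i. *)
all: case/or3P=> [/and3P[/eqP-> /eqP->]|/and4P[]|/and4P[]].
all: try by rewrite !inE => /or4P[] /eqP[-> ->];
  rewrite /= ?inordK // ?eqxx ?orbT.
all: move=> /eqP-> /eqP-> /eqP-> /eqP->; rewrite /= ?inordK //=.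
all: by rewrite -?rev_ord_pred ?ordSK ?ord_predK ?eqxx ?orbT.
Qed.

(** * Orders and trivial intersections of the cyclic factors *)

(** A power of [g1] keeps j, a power of [g2] keeps i, and both keep the type. *)
Lemma TI_g1_g2 : <[g1 n]> :&: <[g2 n]> = 1.
Proof.
apply/trivgP/subsetP=> h /setIP[/cycleP[a ->] /cycleP[b eq_ab]]; apply/set1P.
apply/permP=> x; have := g2X b x; rewrite -eq_ab g1X perm1.
by case: x => -[j i] t /= [_ ->].
Qed.

Lemma order_g3 : 0 < n -> #[g3 n] = 2.
Proof.
move=> n_gt0; apply: nt_prime_order => //; first exact: expg_g3_2.
apply/eqP=> /permP/(_ (Ordinal n_gt0, Ordinal n_gt0, ord0)).
by rewrite permE perm1 => /(congr1 (fun y => val y.2)); rewrite /= inordK.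
Qed.

Lemma order_g4 : 0 < n -> #[g4 n] = 2.
Proof.
move=> n_gt0; apply: nt_prime_order => //; first exact: expg_g4_2.
apply/eqP=> /permP/(_ (Ordinal n_gt0, Ordinal n_gt0, ord0)).
by rewrite permE perm1 => /(congr1 (fun y => val y.2)); rewrite /= inordK.
Qed.

Lemma TI_g3_g4 : 0 < n -> <[g3 n]> :&: <[g4 n]> = 1.
Proof.
move=> n_gt0; apply/trivgP/subsetP=> h /setIP[].
rewrite /= (cycle2g (order_g3 n_gt0)) (cycle2g (order_g4 n_gt0)) !inE.
case/orP=> /eqP->; first by rewrite eqxx.
(* [g3] and [g4] differ at a vertex of type 0: its image has type 1 under the one and 3 under the
   other. *)
case/orP=> [//|/eqP/permP/(_ (Ordinal n_gt0, Ordinal n_gt0, ord0))].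
by rewrite !permE => /(congr1 (fun y => val y.2)); rewrite /= !inordK.
Qed.

(** * Semidirect decomposition and regularity *)

Lemma TRC_sdprod : translations ><| type_changes = TRC_group n.
Proof.
rewrite sdprodEY ?TRC_groupE ?type_changes_norm //.
apply/trivgP/subsetP=> g /setIP[Hg Kg]; apply/set1P/permP=> x.
by rewrite (type_change_free _ x Kg (translation_type _ _ Hg)).
Qed.

Lemma TRC_group_free g x : g \in TRC_group n -> g x = x -> g = 1.
Proof.
rewrite -(sdprodW TRC_sdprod) => /mulsgP[h k Hh Kk ->]; rewrite permM => fix_x.
(* The translation h keeps types, so k must send the type of h x to itself. *)
have k1 : k = 1.
  by apply: (type_change_free _ (h x) Kk); rewrite fix_x translation_type.
by move: fix_x; rewrite k1 perm1 mulg1 => /translation_free->.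
Qed.

End Torus.

Lemma card_cyclic_square k : 0 < k -> #|cyclic_square k| = (k * k)%N.
Proof. by move=> k_gt0; rewrite cardsX card_Zp. Qed.

Theorem theorem2 (n : nat) (n_ge1 : 1 <= n) :
  is_cayley_graph_on [subg TRC_group n]%type (@TRC_adj n) /\
  exists H K : {group {perm vertex n}},
    [/\ H ><| K = TRC_group n, H \isog cyclic_square n & K \isog cyclic_square 2].
Proof.
have isoH : translations n \isog cyclic_square n.
  apply: isog_cyclic_square => //; first exact: commute_g1_g2.
  - exact: TI_g1_g2.
  - exact: order_g1.
  - exact: order_g2.
have isoK : type_changes n \isog cyclic_square 2.
  apply: isog_cyclic_square => //; first exact: commute_g3_g4.
  - exact: TI_g3_g4.
  - exact: order_g3.
  - exact: order_g4.
split; last by exists (translations n), (type_changes n); split; rewrite ?TRC_sdprod.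
apply: (@regular_cayley _ _ _ (Ordinal n_ge1, Ordinal n_ge1, ord0)).
- exact: TRC_adj_sym.
- exact: TRC_adj_irr.
- by move=> g Gg x y; apply: TRC_group_aut.
(* Both cardinals equal n * n * 4, the type changes contributing 2 * 2. *)
- rewrite -(sdprod_card (TRC_sdprod n)) (card_isog isoH) (card_isog isoK).
  by rewrite !card_cyclic_square // !card_prod !card_ord.
- by move=> g Gg /(TRC_group_free _ _ _ Gg).
Qed.
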